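(* Let $1\le r\le k$ and let $\mu,\nu$ be partitions inside the $k\times(n-k)$ rectangle. The expansion coefficients of the triple quantum product satisfy $C_{(1^r)\mu}^{\nu,d}(y,z)\in\mathbb{Z}_{\ge0}[y_i-z_j]$, i.e. they are polynomials with non-negative integer coefficients in the differences $y_i-z_j$, $1\le i,j\le n$.
   Context: Fix $n\ge2$ and $1\le k\le n-1$. Let $\mathbb{A}=\mathbb{Z}[y_1,\ldots,y_n,z_1,\ldots,z_n]$ and let $\mathbb{V}=\mathbb{A}^n$ with standard basis $v_1,\ldots,v_n$; scalars are extended to $\mathbb{A}[q^{\pm1}]$ (or further to a localisation; this is irrelevant for the coefficients). A partition $\mu$ inside the $k\times(n-k)$ rectangle labels the basis vector $|\mu\rangle=v_{w_1}\wedge\cdots\wedge v_{w_k}$ of $\bigwedge^k\mathbb{V}$, where $w_j=\mu_{k+1-j}+j$. The quantised Chern root is the matrix $X^q=(-1)^{k-1}q\,E_{1,n}+\sum_{i=1}^{n-1}E_{i+1,i}+\sum_{i=1}^ny_iE_{ii}$ with $E_{ij}v_j=v_i$; $X_i^q$ denotes $X^q$ acting in the $i$-th factor of $\mathbb{V}^{\otimes k}$. Symmetric polynomials in $X_1^q,\ldots,X_k^q$ descend to $\bigwedge^k\mathbb{V}$. The factorial Schur polynomial with parameters $z$ is $s_\lambda(x_1,\ldots,x_k|z)=\det\big(\prod_{a=1}^{\lambda_i+k-i}(x_j-z_a)\big)_{1\le i,j\le k}/\prod_{i<j}(x_i-x_j)$. The triple quantum product and its coefficients are defined by $$|\lambda\rangle\star_z|\mu\rangle=s_\lambda(X_1^q,\ldots,X_k^q|z)|\mu\rangle=\sum_{\nu,d}q^dC_{\lambda\mu}^{\nu,d}(y,z)|\nu\rangle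 ,\qquad C_{\lambda\mu}^{\nu,d}(y,z)\in\mathbb{A}.$$ *)

(* Defs.v *)
From HB Require Import structures.
From mathcomp Require Import all_boot all_order all_algebra all_fingroup.
From mathcomp Require Export mpoly.

Set Implicit Arguments.
Unset Strict Implicit.
Unset Printing Implicit Defensive.

Import Order.TTheory GRing.Theory Num.Theory.
Local Open Scope ring_scope.

(* Indices are 0-based throughout: 'I_n and 'I_k stand for {1..n} and {1..k}. *)

Section Partitions.
Variables n k : nat.

(* Partitions inside the k x (n - k) rectangle, as the k-tuple of their parts;
   [lam i + k <= n] is [lam i <= n - k] without truncated subtraction. *)
Definition is_boxpart (lam : {ffun 'I_k -> 'I_n}) : bool :=
  [forall i, lam i + k <= n]%N
  && [forall i : 'I_k, forall j : 'I_k, (i <= j) ==> (lam j <= lam i)]%N.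

Record boxpart := BoxPart {
  parts :> {ffun 'I_k -> 'I_n};
  partsP : is_boxpart parts
}.
HB.instance Definition _ := [isSub for parts].
HB.instance Definition _ := [Finite of boxpart by <:].

Lemma boxpart_le (lam : boxpart) i : (lam i + k <= n)%N.
Proof. by case/andP: (partsP lam) => /forallP. Qed.

Lemma boxpart_noninc (lam : boxpart) (i j : 'I_k) :
  (i <= j)%N -> (lam j <= lam i)%N.
Proof.
by case/andP: (partsP lam) => _ /forallP/(_ i)/forallP/(_ j)/implyP.
Qed.

Fact wedge_idx_subproof (mu : boxpart) (j : 'I_k) :
  (mu (rev_ord j) + j < n)%N.
Proof.
by apply: leq_trans (boxpart_le mu (rev_ord j)); rewrite ltn_add2l.
Qed.

(* The indices w_j of |mu> = v_(w_1) /\ ... /\ v_(w_k). *)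
Definition wedge_idx (mu : boxpart) : {ffun 'I_k -> 'I_n} :=
  [ffun j => Ordinal (wedge_idx_subproof mu j)].

Lemma wedge_idx_mono (mu : boxpart) (i j : 'I_k) :
  (i < j)%N -> (wedge_idx mu i < wedge_idx mu j)%N.
Proof.
move=> ltij; rewrite !ffunE /= -addnS leq_add //.
by apply: boxpart_noninc; rewrite /= leq_sub2l // ltnS ltnW.
Qed.

Lemma wedge_idx_inj (mu : boxpart) : injective (wedge_idx mu).
Proof.
move=> i j eqw; apply/val_inj/eqP; case: ltngtP => // /(wedge_idx_mono mu);
  by rewrite eqw ltnn.
Qed.

Hypothesis ltkn : (k < n)%N.

Fact colpart_val_subproof r (i : 'I_k) : ((i < r)%N < n)%N.
Proof.
apply: leq_ltn_trans (leq_b1 _) _.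
by apply: leq_trans ltkn; rewrite ltnS (leq_ltn_trans _ (ltn_ord i)).
Qed.

Fact colpart_subproof r :
  is_boxpart [ffun i => Ordinal (colpart_val_subproof r i)].
Proof.
apply/andP; split; apply/forallP => i.
  by rewrite ffunE /= (leq_trans _ ltkn) // -[k.+1]add1n leq_add2r leq_b1.
apply/forallP => j; apply/implyP => leij; rewrite !ffunE /=.
by case: (ltnP j r) => // /(leq_ltn_trans leij) ->.
Qed.

(* The one-column partition (1^r), for r <= k. *)
Definition colpart (r : nat) : boxpart := BoxPart (colpart_subproof r).

End Partitions.

(* Bialternants det(p_i(x_j)) are divisible by the Vandermonde product, which
   gives sense to the quotient defining the factorial Schur polynomials. *)
Section Bialternant.
Variable R : comNzRingType.

Lemma bialternant_dvd k (p : 'I_k -> {poly R}) (x : 'I_k -> R) :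
  exists s, s * (\prod_(i < k) \prod_(j < k | (i < j)%N) (x i - x j))
            = \det (\matrix_(i < k, j < k) (p i).[x j]).
Proof.
elim: k p x => [|k IHk] p x.
  by exists 1; rewrite big_ord0 mul1r det_mx00.
have /fin_all_exists[q qE] (i : 'I_k.+1) :
    exists q, p i - (p i).[x ord0]%:P = q * ('X - (x ord0)%:P).
  by apply/factor_theorem; rewrite rootE !hornerE subrr.
pose y j := x (lift ord0 j).
have /fin_all_exists[s sE] (i : 'I_k.+1) := IHk (fun l => q (lift i l)) y.
pose N : 'M[R]_(k.+1) := \matrix_(i, j)
  if j == ord0 then (p i).[x ord0] else (q i).[x j].
pose T : 'M[R]_(k.+1) := \matrix_(i, j)
  if i == ord0 then 1 else (x i - x ord0) *+ (i == j).
have -> : \matrix_(i < k.+1, j < k.+1) (p i).[x j] = N *m T.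
  apply/matrixP => i j; rewrite !mxE big_ord_recl !mxE eqxx mulr1.
  have -> : (p i).[x j] = (p i).[x ord0] + (q i).[x j] * (x j - x ord0).
    have /(congr1 (horner^~ (x j))) := qE i.
    by rewrite !hornerE => <-; rewrite addrCA subrr addr0.
  congr (_ + _); case: (unliftP ord0 j) => [j'|] ->; last first.
    rewrite subrr mulr0 big1 // => l _.
    by rewrite !mxE /= mulr0n mulr0.
  rewrite (bigD1 j') //= big1 ?addr0 => [|l nlj]; first by rewrite !mxE /= eqxx.
  by rewrite !mxE /= (inj_eq lift_inj) (negPf nlj) mulr0n mulr0.
have detT : \det T = \prod_(j < k) (y j - x ord0).
  rewrite -det_tr det_trig; last first.
    apply/is_trig_mxP => i j ltij; rewrite !mxE.
    have /negPf-> : j != ord0 by rewrite -val_eqE /= -lt0n (leq_ltn_trans _ ltij).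
    by rewrite -val_eqE /= gtn_eqF.
  rewrite big_ord_recl !mxE /= mul1r; apply: eq_bigr => j _.
  by rewrite !mxE /= eqxx.
have vdmE : \prod_(i < k.+1) \prod_(j < k.+1 | (i < j)%N) (x i - x j)
    = ((-1) ^+ k * \det T) * \prod_(i < k) \prod_(j < k | (i < j)%N) (y i - y j).
  rewrite big_ord_recl detT; congr (_ * _).
    rewrite big_mkcond big_ord_recl /= mul1r -[in (-1) ^+ k](card_ord k) -prodrN.
    by apply: eq_bigr => j _; rewrite opprB.
  apply: eq_bigr => i _; rewrite big_mkcond big_ord_recl /= mul1r.
  by rewrite [RHS]big_mkcond; apply: eq_bigr => j _.
exists ((\sum_i (p i).[x ord0] * ((-1) ^+ i * s i)) * (-1) ^+ k).
rewrite vdmE det_mulmx (expand_det_col N ord0) -!mulrA signrMK.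
rewrite [\det T * _]mulrC mulrA; congr (_ * _).
rewrite mulr_suml; apply: eq_bigr => i _.
rewrite mxE /= /cofactor addn0 -!mulrA; congr (_ * (_ * _)).
rewrite sE; congr (\det _); apply/matrixP => a b; rewrite !mxE.
by rewrite -val_eqE.
Qed.

End Bialternant.

Section FactorialSchur.
Variables n k : nat.

(* The ring Z[y_1, .., y_n, z_1, .., z_n]. *)
Local Notation A := {mpoly int[n + n]}.

Definition yvar (i : 'I_n) : A := 'X_(lshift n i).
Definition zvar (i : 'I_n) : A := 'X_(rshift n i).

(* In 1-based terms a ranges over 1 <= a <= lam_i + k - i, and lam_i + k - i is
   at most n - 1 in the rectangle: the bound a < n loses no factor. *)
Definition fschur_num (lam : boxpart n k) : {mpoly A[k]} :=
  \det (\matrix_(i < k, j < k)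
          \prod_(a < n | (a < lam i + (k - i.+1))%N) ('X_j - (zvar a)%:MP)).

Definition fschur_den : {mpoly A[k]} :=
  \prod_(i < k) \prod_(j < k | (i < j)%N) ('X_i - 'X_j).

Fact fschur_subproof (lam : boxpart n k) :
  exists s : {mpoly A[k]}, s * fschur_den == fschur_num lam.
Proof.
pose p (i : 'I_k) : {poly {mpoly A[k]}} :=
  \prod_(a < n | (a < lam i + (k - i.+1))%N) ('X - ((zvar a)%:MP)%:P).
have [s sE] := bialternant_dvd p (fun j => 'X_j).
exists s; apply/eqP; rewrite /fschur_den sE; congr (\det _).
apply/matrixP => i j; rewrite !mxE horner_prod.
by apply: eq_bigr => a _; rewrite !hornerE.
Qed.

(* The factorial Schur polynomial s_lam(x_1, .., x_k | z), i.e. the exact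
   quotient fschur_num lam / fschur_den (see fschurP and fschur_uniq). *)
Definition fschur (lam : boxpart n k) : {mpoly A[k]} :=
  xchoose (fschur_subproof lam).

Lemma fschurP lam : fschur lam * fschur_den = fschur_num lam.
Proof. exact/eqP/(xchooseP (fschur_subproof lam)). Qed.

Lemma fschur_den_neq0 : fschur_den != 0.
Proof.
apply/prodf_neq0 => i _; apply/prodf_neq0 => j ltij.
rewrite subr_eq0; apply/eqP => /(congr1 (mcoeff U_(i)))/eqP.
have /negPf nji : j != i by rewrite neq_ltn ltij orbT.
by rewrite !mcoeffXU eqxx nji oner_eq0.
Qed.

Lemma fschur_uniq lam s : s * fschur_den = fschur_num lam -> s = fschur lam.
Proof. by rewrite -fschurP => /(mulIf fschur_den_neq0). Qed.

End FactorialSchur.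

Section TensorPower.
Variables (R : comNzRingType) (n k : nat).

(* The tensor power V^{(x) k} of V = R^n: the value of t at u is the coefficient
   of t on v_(u_1) (x) ... (x) v_(u_k). *)
Definition tens : Type := {ffun {ffun 'I_k -> 'I_n} -> R}.

Definition tens_basis (u : {ffun 'I_k -> 'I_n}) : tens :=
  [ffun u' : {ffun 'I_k -> 'I_n} => (u' == u)%:R].

Definition set_idx (u : {ffun 'I_k -> 'I_n}) (i : 'I_k) (a : 'I_n) :
  {ffun 'I_k -> 'I_n} := [ffun j => if j == i then a else u j].

(* The endomorphism X of V (X v_a = \sum_b X b a v_b) acting in factor i. *)
Definition tens_act (X : 'M[R]_n) (i : 'I_k) (t : tens) : tens :=
  [ffun u : {ffun 'I_k -> 'I_n} => \sum_(a < n) X (u i) a * t (set_idx u i a)].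

(* X_1^(m_1) ... X_k^(m_k); these operators commute. *)
Definition tens_monom (X : 'M[R]_n) (m : 'X_{1..k}) (t : tens) : tens :=
  foldr (fun i => iter (m i) (tens_act X i)) t (enum 'I_k).

(* f(X_1, .., X_k), for a polynomial f with coefficients in R. *)
Definition tens_eval (X : 'M[R]_n) (f : {mpoly R[k]}) (t : tens) : tens :=
  [ffun u : {ffun 'I_k -> 'I_n} => \sum_(m <- msupp f) f@_m * tens_monom X m t u].

(* The exterior power, with basis the |nu>. *)
Definition extp : Type := {ffun boxpart n k -> R}.

(* The projection from the tensor power, which sends v_(u_1) (x) ... (x) v_(u_k)
   to v_(u_1) /\ ... /\ v_(u_k), i.e. to (-1)^s |nu> if u = w_nu \o s for a
   permutation s, and to 0 if u has a repeated entry. *)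
Definition wedge (t : tens) : extp :=
  [ffun nu : boxpart n k =>
     \sum_(s : 'S_k) (-1) ^+ s * t [ffun j => wedge_idx nu (s j)]].

Lemma wedge_tperm (u : {ffun 'I_k -> 'I_n}) (i j : 'I_k) : i != j ->
  forall nu, wedge (tens_basis [ffun l => u (tperm i j l)]) nu
             = - wedge (tens_basis u) nu.
Proof.
move=> nij nu; rewrite !ffunE -sumrN (reindex_inj (mulgI (tperm i j))) /=.
apply: eq_bigr => s _; rewrite odd_permM odd_tperm nij signr_addb expr1 !mulN1r.
rewrite mulNr !ffunE; congr (- (_ * (nat_of_bool _)%:R)).
apply/eqP/eqP => [eqf|<-]; last by apply/ffunP => l; rewrite !ffunE permM.
apply/ffunP => l; have /ffunP/(_ (tperm i j l)) := eqf.
by rewrite !ffunE permM tpermK.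
Qed.

Lemma wedge_repeat (u : {ffun 'I_k -> 'I_n}) (i j : 'I_k) :
  i != j -> u i = u j -> forall nu, wedge (tens_basis u) nu = 0.
Proof.
move=> nij equ nu; rewrite ffunE big1 // => s _; rewrite ffunE.
case: eqP => [eqf|_]; last by rewrite mulr0.
move: equ; rewrite -eqf ffunE [X in _ = X]ffunE => /wedge_idx_inj/perm_inj/eqP.
by rewrite (negPf nij).
Qed.

Lemma wedge_basis (mu nu : boxpart n k) :
  wedge (tens_basis (wedge_idx mu)) nu = (nu == mu)%:R.
Proof.
have incr_id (s : 'S_k) : (forall i j : 'I_k, (i < j)%N -> (s i < s j)%N) ->
    forall i : 'I_k, (i <= s i)%N.
  move=> s_incr [m]; elim: m => // m IHm ltmk.
  have ltm : (m < k)%N by exact: ltnW.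
  apply: leq_ltn_trans (IHm ltm) _.
  exact: (s_incr (Ordinal ltm) (Ordinal ltmk)).
have idx_ltE (la : boxpart n k) (i j : 'I_k) :
    (wedge_idx la i < wedge_idx la j)%N = (i < j)%N.
  apply/idP/idP => [|/wedge_idx_mono//]; apply: contraTT; rewrite -!leqNgt.
  by rewrite leq_eqVlt => /predU1P[/val_inj->//|/(wedge_idx_mono la)/ltnW].
have sameP (s : 'S_k) :
    [ffun j => wedge_idx nu (s j)] = wedge_idx mu -> s = 1%g /\ nu = mu.
  move=> eqf; have eqs j : wedge_idx nu (s j) = wedge_idx mu j.
    by rewrite -eqf [RHS]ffunE.
  have s_mono (i j : 'I_k) : (s i < s j)%N = (i < j)%N by rewrite -(idx_ltE nu) !eqs idx_ltE.
  have s1 : s = 1%g.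
    apply/permP => i; rewrite perm1; apply/val_inj/eqP; rewrite eqn_leq.
    apply/andP; split; last by apply: incr_id => a b; rewrite s_mono.
    have := incr_id (s^-1)%g _ (s i); rewrite permK; apply=> a b ltab.
    by rewrite -s_mono !permKV.
  split=> //; apply/val_inj/ffunP => i; apply/val_inj => /=.
  have := congr1 val (eqs (rev_ord i)).
  by rewrite s1 perm1 !ffunE /= rev_ordK => /addIn.
rewrite ffunE (bigD1 1%g) //= odd_perm1 mul1r big1 ?addr0 => [|s /eqP ns1].
  rewrite ffunE; congr (nat_of_bool _)%:R.
  apply/eqP/eqP => [/sameP[]//|->]; apply/ffunP => j.
  by rewrite ffunE perm1.
by rewrite ffunE; case: eqP => [/sameP[]|]; rewrite ?mulr0.
Qed.

End TensorPower.

Section QuantumProduct.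
Variables n k : nat.
Local Notation A := {mpoly int[n + n]}.

(* The quantised Chern root X^q, over A[q] = {poly A} with q = 'X. Its entries
   have no negative power of q, so A[q] may replace A[q, q^-1]. *)
Definition chern_root : 'M[{poly A}]_n :=
  \matrix_(i < n, j < n)
    (((-1) ^+ k.-1 * 'X) *+ ((i == 0 :> nat) && (j == n.-1 :> nat))
     + 1 *+ (i == j.+1 :> nat)
     + (yvar i)%:P *+ (i == j)).

(* |lam> star_z |mu>. *)
Definition tqprod (lam mu : boxpart n k) : extp {poly A} n k :=
  wedge (tens_eval chern_root (map_mpoly polyC (fschur lam))
                   (tens_basis {poly A} (wedge_idx mu))).

(* C_(lam mu)^(nu, d)(y, z). *)
Definition tqcoef (lam mu nu : boxpart n k) (d : nat) : A :=
  (tqprod lam mu nu)`_d.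

(* Polynomials with non-negative integer coefficients in the y_i - z_j. *)
Definition nonneg_in_differences (c : A) : Prop :=
  exists p : {mpoly int[#|{: 'I_n * 'I_n}|]},
    (forall m, 0 <= p@_m)
    /\ c = p \mPo [tuple yvar (enum_val l).1 - zvar (enum_val l).2 | l < _].

End QuantumProduct.

(* Main.v *)
Require Import Defs.
From mathcomp Require Import all_boot all_order all_algebra.
From mathcomp Require Import all_fingroup.
From mathcomp Require Import ring zify.

Set Implicit Arguments.
Unset Strict Implicit.
Unset Printing Implicit Defensive.

Import Order.TTheory GRing.Theory Num.Theory.
Local Open Scope ring_scope.

(** The factorial elementary polynomial s_(1^r)(x_1, .., x_k | z) is the sum,
    over the r-subsets t_1 < .. < t_r of the variables, of the products of the
    x_(t_i) - z_(t_i - i + 1).  It is therefore of degree at most 1 in each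
    variable, and when it acts on v_(w_1) (x) .. (x) v_(w_k) each of the
    factors is hit at most once.  A hit by X - z_a turns v_b into
    v_(b+1) + (y_b - z_a) v_b, where v_(n+1) stands for (-1)^(k-1) q v_1.  So
    the result is a combination of the tensors obtained by moving the positions
    in some set S one step forward, whose coefficients are sums of products of
    differences y_b - z_a, times one factor (-1)^(k-1) q if v_n was moved
    ([shift_expansion_felem]).

    It remains to see that no sign survives in the exterior power
    ([wedge_shift]).  As w is strictly increasing, moving some of its entries by
    at most one step leaves it weakly increasing, and such a tensor projects to
    0 or to a basis vector.  The only exception is the wrap-around of the last
    position from n to 1; then rotating this entry to the front costs the sign
    (-1)^(k-1) of a k-cycle, which cancels the sign in front of q.

    The formula for s_(1^r) is used in the form of the recursion on the number
    of variables ([felem]).  It is identified with the quotient of determinants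
    by expanding the product of the t - x_i in the Newton basis
    (t - z_1)..(t - z_m): its coefficients satisfy the same recursion
    ([prod_newton]), and at t = x_j the expansion vanishes, which expresses the
    one new row of the numerator through the rows of the factorial Vandermonde
    matrix ([det_newton_column]). *)

(** * Determinants in the Newton basis *)

Section NewtonDeterminants.
Variable R : comNzRingType.

Lemma det_monic_bialternant k (p : 'I_k -> {poly R}) (a : 'I_k -> R) :
  (forall i, p i \is monic) -> (forall i, size (p i) = i.+1) ->
  \det (\matrix_(i, j) (p i).[a j])
    = \prod_(i < k) \prod_(j < k | (i < j)%N) (a j - a i).
Proof.
move=> p_monic size_p; pose L : 'M[R]_k := \matrix_(i, j) (p i)`_j.
have -> : \matrix_(i, j) (p i).[a j] = L *m Vandermonde k (\row_j a j).
  apply/matrixP => i j; rewrite !mxE (@horner_coef_wide _ k) ?size_p //.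
  by apply: eq_bigr => l _; rewrite !mxE.
rewrite det_mulmx det_Vandermonde det_trig; last first.
  by apply/is_trig_mxP => i j ltij; rewrite mxE nth_default ?size_p.
rewrite big1 ?mul1r => [|i _]; last first.
  by have /monicP := p_monic i; rewrite mxE lead_coefE size_p.
by apply: eq_bigr => i _; apply: eq_bigr => j _; rewrite !mxE.
Qed.

Lemma det_rev k (M : 'M[R]_k) :
  \det (\matrix_(i, j) M (rev_ord i) (rev_ord j)) = \det M.
Proof.
pose s := perm (@rev_ord_inj k).
have -> : \matrix_(i, j) M (rev_ord i) (rev_ord j) = row_perm s (col_perm s M).
  by apply/matrixP => i j; rewrite !mxE !permE.
rewrite row_permE col_permE !det_mulmx !det_perm odd_permV mulrCA -signr_addb.
by rewrite addbb mulr1.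
Qed.

Variables x z : nat -> R.

(** The factorial power (t|z)^m. *)
Definition newton m (t : R) := \prod_(a < m) (t - z a).

Lemma newtonS m t : newton m.+1 t = newton m t * (t - z m).
Proof. exact: big_ord_recr. Qed.

(** The factorial elementary polynomial s_(1^r)(x_0, .., x_(j-1) | z): the two
    summands collect the r-subsets of variables that avoid, resp. contain, the
    last one.  In the second case r' chosen variables come before x_j', so that
    the content shift gives it the parameter z_(j' - r'). *)
Fixpoint felem j r : R :=
  match j, r with
  | 0, 0 => 1
  | 0, _.+1 => 0
  | j'.+1, 0 => felem j' 0
  | j'.+1, r'.+1 => felem j' r'.+1 + (x j' - z (j' - r')) * felem j' r'
  end.

Lemma felem0 j : felem j 0 = 1.
Proof. by elim: j. Qed.

Lemma felem_gt j r : (j < r)%N -> felem j r = 0.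
Proof.
elim: j r => [|j IHj] [|r] //= ltjr.
by rewrite !IHj ?mulr0 ?addr0 // ltnW.
Qed.

(** Multiplying by t - x_j = (t - z_m) + (z_m - x_j) sends (t|z)^m to
    (t|z)^(m+1) + (z_m - x_j) (t|z)^m; comparing the coefficients of the Newton
    basis gives exactly the recursion that defines [felem]. *)
Lemma prod_newton j t :
  \prod_(i < j) (t - x i)
    = \sum_(r < j.+1) (-1) ^+ r * felem j r * newton (j - r) t.
Proof.
elim: j => [|j IHj].
  by rewrite big_ord0 big_ord1 /newton big_ord0 !mulr1.
(* F and G collect the two summands of the recursion for felem j.+1 r. *)
pose F r := (-1) ^+ r * felem j r * newton (j.+1 - r) t.
pose G r := if r is r'.+1
  then (-1) ^+ r * ((x j - z (j - r')) * felem j r') * newton (j - r') t else 0.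
have -> : \sum_(r < j.+2) (-1) ^+ r * felem j.+1 r * newton (j.+1 - r) t
          = \sum_(r < j.+2) (F r + G r).
  apply: eq_bigr => -[[|r] ltrj] _ /=; rewrite /F /G ?addr0 ?felem0 //.
  by rewrite subSS mulrDr mulrDl.
rewrite big_split /= [X in X + _]big_ord_recr /= [X in _ + X]big_ord_recl /=.
rewrite {2}/F felem_gt // mulr0 mul0r addr0 add0r -big_split /=.
rewrite big_ord_recr /= IHj mulr_suml; apply: eq_bigr => -[r ltrj] _.
rewrite /F /G /= add0n subSn // newtonS exprS; ring.
Qed.

(** The powers (t|z)^m are monic of degree m, hence a unitriangular change of
    basis from the monomials; the rows come in decreasing degree, whence the
    reversal of both indices. *)
Lemma det_newton k :
  \det (\matrix_(i < k, j < k) newton (k - i.+1) (x j))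
    = \prod_(i < k) \prod_(j < k | (i < j)%N) (x i - x j).
Proof.
pose p (i : 'I_k) : {poly R} := \prod_(a < i) ('X - (z a)%:P).
have -> : \prod_(i < k) \prod_(j < k | (i < j)%N) (x i - x j)
    = \prod_(i < k) \prod_(j < k | (i < j)%N) (x (rev_ord j) - x (rev_ord i)).
  rewrite [RHS](exchange_big_dep predT) //= (reindex_inj rev_ord_inj) /=.
  apply: eq_bigr => i _; rewrite (reindex_inj rev_ord_inj) /=.
  by apply: eq_bigl => j; have := ltn_ord i; have := ltn_ord j; lia.
rewrite -(det_monic_bialternant (p := p) (fun j => x (rev_ord j))).
- rewrite -det_rev; congr (\det _); apply/matrixP => i j; rewrite !mxE /p.
  rewrite horner_prod /newton /= subnSK // subKn 1?ltnW //.
  by apply: eq_bigr => a _; rewrite !hornerE.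
- by move=> i; apply: monic_prod_XsubC.
- move=> i; rewrite /p size_prod_XsubC [index_enum _]unlock -enumT size_enum_ord.
  by [].
Qed.

(** The rows of the numerator for (1^r) have the degrees k, .., k - r + 1 and
    k - r - 1, .., 0.  All but the first are rows of the factorial Vandermonde
    matrix, and the first one is a combination of such rows by [prod_newton]
    evaluated at t = x_j.  In the determinant of the transition matrix C only
    the coefficient of the missing row, of degree k - r, survives. *)
Lemma det_newton_column k r : (0 < r <= k)%N ->
  \det (\matrix_(i < k, j < k) newton ((i < r)%N + (k - i.+1)) (x j))
    = felem k r * \prod_(i < k) \prod_(j < k | (i < j)%N) (x i - x j).
Proof.
case: r k => [|r] [|k] //= ltrk; rewrite -det_newton.
pose C : 'M[R]_k.+1 := \matrix_(i, j)
  if i == ord0 then (-1) ^+ j * felem k.+1 j.+1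
  else if (i < r.+1)%N then (j.+1 == i :> nat)%:R else (j == i)%:R.
have -> : \matrix_(i < k.+1, j < k.+1) newton ((i < r.+1)%N + (k.+1 - i.+1)) (x j)
          = C *m \matrix_(i < k.+1, j < k.+1) newton (k.+1 - i.+1) (x j).
  apply/matrixP => i j; rewrite !mxE; case: (unliftP ord0 i) => [i'|] ->.
    (* l is the row of the Vandermonde matrix that has the degree of row i. *)
    pose l : 'I_k.+1 := inord (if (i'.+1 < r.+1)%N then i' : nat else i'.+1).
    have lE : l = (if (i'.+1 < r.+1)%N then i' : nat else i'.+1) :> nat.
      by rewrite inordK //; have := ltn_ord i'; case: ifP; lia.
    rewrite (bigD1 l) //= big1 ?addr0 => [|m /negPf neq_ml]; rewrite !mxE.
      have lti : (i'.+1 < k.+1)%N := ltn_ord i'.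
      rewrite -!val_eqE /= lE /bump /= add1n.
      case: ltnP => _; rewrite eqxx mul1r //.
      by rewrite -[nat_of_bool true]/1%N add1n subnSK.
    move: neq_ml; rewrite -!val_eqE /= lE /bump /= add1n => neq_ml.
    by case: ltnP neq_ml => _; rewrite ?eqSS => ->; rewrite mul0r.
  have := prod_newton k.+1 (x j); rewrite (bigD1 j) //= subrr mul0r.
  rewrite big_ord_recl /= subn0 felem0 !mul1r => /esym/eqP.
  rewrite addr_eq0 => /eqP eq_newton.
  rewrite add1n subSS subn0 eq_newton -sumrN.
  apply: eq_bigr => l _; rewrite !mxE /= exprS !mulN1r !mulNr opprK.
  by [].
rewrite det_mulmx; congr (_ * _).
rewrite (expand_det_row _ ord0) (bigD1 (Ordinal ltrk)) //= big1 ?addr0.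
  rewrite mxE eqxx /cofactor mulrACA -exprD /= add0n.
  rewrite addnn -mul2n exprM sqrrN !expr1n mul1r.
  rewrite (_ : row' _ _ = 1%:M) ?det1 ?mulr1 //; apply/matrixP => a b.
  rewrite !mxE -!val_eqE /= /bump /= add1n ltnS.
  by case: (leqP r b) => lerb; case: (ltnP a r) => lear; congr _%:R;
    rewrite -?[nat_of_bool true]/1%N -?[nat_of_bool false]/0%N;
    move: (a : nat) (b : nat) lerb lear => {}a {}b lerb lear; apply/eqP/eqP; lia.
(* If another column is removed, column r stays in the minor and is zero. *)
move=> j neq_jr; rewrite /cofactor.
case: (unliftP j (Ordinal ltrk)) neq_jr => [c eq_c|<-]; last by rewrite eqxx.
move=> _; rewrite (expand_det_col _ c) big1 ?mulr0 // => a _.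
rewrite !mxE -eq_c -!val_eqE /= /bump /= add1n ltnS.
by case: ltnP => lear; [rewrite eqSS gtn_eqF | rewrite ltn_eqF]; rewrite ?mul0r.
Qed.
End NewtonDeterminants.

(** * The factorial Schur polynomial of a column *)

(** The index bounds k and n of the variables are lifted to all natural numbers,
    so that [felem] can recurse freely; the default values i0 and a0 are never
    reached. *)
Lemma fschur_colpart n k r (ltkn : (k < n)%N) (i0 : 'I_k) (a0 : 'I_n) :
  (0 < r <= k)%N ->
  fschur (colpart ltkn r)
    = felem (fun j => 'X_(insubd i0 j)) (fun a => (zvar (insubd a0 a))%:MP) k r.
Proof.
move=> r_range; apply/esym/fschur_uniq.
rewrite /fschur_den /fschur_num.
set x := fun j : nat => _; set z := fun a : nat => _.
have xE (i : 'I_k) : 'X_i = x i by rewrite /x valKd.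
transitivity (felem x z k r * \prod_(i < k) \prod_(j < k | (i < j)%N) (x i - x j)).
  by congr (_ * _); apply: eq_bigr => i _; apply: eq_bigr => j _; rewrite !xE.
rewrite -(det_newton_column x z r_range).
congr (\det _); apply/matrixP => i j; rewrite [LHS]mxE [RHS]mxE.
rewrite ffunE /= /newton; set m := ((i < r)%N + _)%N.
have le_mn : (m <= n)%N.
  apply: leq_trans (leq_add (leq_b1 _) (leqnn _)) _.
  by rewrite add1n subnSK // (leq_trans (leq_subr _ _)) // ltnW.
rewrite (big_ord_widen n (fun a => x j - z a)) //.
by apply: eq_bigr => a _; rewrite xE /z valKd.
Qed.

(** * Polynomials in commuting operators on the tensor power *)

Section TensEval.
Variables (R : comNzRingType) (n k : nat) (X : 'M[R]_n).
Implicit Types (t : tens R n k) (f g : {mpoly R[k]}) (u v : {ffun 'I_k -> 'I_n}).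

Lemma tens_eval_sum (s : seq 'X_{1..k}) f t u :
  uniq s -> {subset msupp f <= s} ->
  tens_eval X f t u = \sum_(m <- s) f@_m * tens_monom X m t u.
Proof.
move=> uniq_s sub_s; rewrite ffunE [RHS](bigID (mem (msupp f))) /=.
rewrite [X in _ + X]big1 ?addr0 => [|m /memN_msupp_eq0->]; last by rewrite mul0r.
rewrite -[RHS]big_filter; apply: perm_big; apply: uniq_perm => //.
  exact: filter_uniq.
by move=> m; rewrite mem_filter andb_idr //; apply: sub_s.
Qed.

Lemma tens_evalD f g t u :
  tens_eval X (f + g) t u = tens_eval X f t u + tens_eval X g t u.
Proof.
pose s := undup (msupp f ++ msupp g).
have uniq_s : uniq s := undup_uniq _.
rewrite !(@tens_eval_sum s) ?big_split /=.
- by rewrite -big_split; apply: eq_bigr => m _; rewrite mcoeffD mulrDl.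
- by [].
- by move=> m; rewrite mem_undup mem_cat orbC => ->.
- by [].
- by move=> m; rewrite mem_undup mem_cat => ->.
- by [].
- by move=> m /msuppD_le; rewrite mem_undup.
Qed.

Lemma tens_evalZ c f t u : tens_eval X (c%:MP * f) t u = c * tens_eval X f t u.
Proof.
rewrite (@tens_eval_sum (msupp f)) => [||m]; last 2 first.
- exact: msupp_uniq.
- by rewrite !mcoeff_msupp mcoeffCM; apply: contra_neq => ->; rewrite mulr0.
by rewrite ffunE mulr_sumr; apply: eq_bigr => m _; rewrite mcoeffCM mulrA.
Qed.

Lemma tens_eval1 t u : tens_eval X 1 t u = t u.
Proof.
rewrite ffunE msupp1 big_seq1 mcoeff1 eqxx mul1r /tens_monom.
by elim: (enum _) => //= i s; rewrite mnm0E.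
Qed.

Lemma tens_actC i j t :
  tens_act X i (tens_act X j t) = tens_act X j (tens_act X i t).
Proof.
have [-> //|neq_ij] := eqVneq i j.
apply/ffunP => u; rewrite !ffunE.
under eq_bigr => a _ do rewrite ffunE mulr_sumr.
under [RHS]eq_bigr => a _ do rewrite ffunE mulr_sumr.
rewrite exchange_big; apply: eq_bigr => a _; apply: eq_bigr => b _.
have /negPf neq_ji : j != i by rewrite eq_sym.
rewrite !ffunE neq_ji (negPf neq_ij) mulrCA.
congr (_ * (_ * t _)); apply/ffunP => l; rewrite !ffunE.
by case: (eqVneq l i) => // ->; rewrite (negPf neq_ij).
Qed.

(** The monomials of [tens_monom] apply the operators in a fixed order; moving a
    new factor to its place needs [tens_actC]. *)
Lemma tens_monomU i m t :
  tens_monom X (U_(i) + m)%MM t = tens_act X i (tens_monom X m t).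
Proof.
rewrite /tens_monom.
have iterC l p t' : iter p (tens_act X l) (tens_act X i t')
                    = tens_act X i (iter p (tens_act X l) t').
  by elim: p => //= p ->; rewrite tens_actC.
have foldE s : uniq s ->
    foldr (fun l => iter ((U_(i) + m)%MM l) (tens_act X l)) t s
    = iter (i \in s) (tens_act X i) (foldr (fun l => iter (m l) (tens_act X l)) t s).
  elim: s => //= l s IHs /andP[l_notin_s /IHs->].
  rewrite in_cons mnmDE mnm1E; case: eqVneq => [->|neq_il] /=.
    by rewrite (negPf l_notin_s).
  by case: (i \in s) => //=; rewrite iterC.
by rewrite foldE ?enum_uniq // mem_enum.
Qed.

Lemma tens_evalX i f t : tens_eval X ('X_i * f) t = tens_act X i (tens_eval X f t).
Proof.
apply/ffunP => u; rewrite !ffunE mulrC (perm_big _ (msuppMX f U_(i))) big_map.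
under [RHS]eq_bigr => a _ do rewrite ffunE mulr_sumr.
rewrite exchange_big; apply: eq_bigr => m _ /=.
rewrite mcoeffMX tens_monomU ffunE mulr_sumr.
by apply: eq_bigr => a _; rewrite mulrCA.
Qed.

Lemma tens_act_sum (I : finType) (c : I -> R) (v : I -> {ffun 'I_k -> 'I_n}) i t :
  (forall u, t u = \sum_(l : I) c l * (u == v l)%:R) ->
  forall u, tens_act X i t u
    = \sum_(l : I) c l * (X (u i) (v l i) * (u == set_idx (v l) i (u i))%:R).
Proof.
move=> tE u; rewrite ffunE; under eq_bigr => a _ do rewrite tE mulr_sumr.
rewrite exchange_big; apply: eq_bigr => l _ /=.
rewrite (bigD1 (v l i)) //= big1 ?addr0 => [|a neq_a].
  rewrite mulrCA; congr (_ * (_ * (nat_of_bool _)%:R)).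
  by apply/eqP/eqP => /ffunP eq_u; apply/ffunP => j; have := eq_u j;
    rewrite !ffunE; case: eqP => // ->.
case: eqP => [eq_v|_]; last by rewrite !mulr0.
by move: neq_a; rewrite -eq_v ffunE eqxx eqxx.
Qed.

Lemma wedge_sum (I : finType) (c : I -> R) (v : I -> {ffun 'I_k -> 'I_n}) t :
  (forall u, t u = \sum_(l : I) c l * (u == v l)%:R) ->
  forall nu, wedge t nu = \sum_(l : I) c l * wedge (tens_basis R (v l)) nu.
Proof.
move=> tE nu; rewrite ffunE; under eq_bigr => s _ do rewrite tE mulr_sumr.
rewrite exchange_big; apply: eq_bigr => l _; rewrite ffunE mulr_sumr.
by apply: eq_bigr => s _; rewrite ffunE mulrCA.
Qed.

Lemma wedge_perm (s : 'S_k) u nu :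
  wedge (tens_basis R [ffun l => u (s l)]) nu = (-1) ^+ s * wedge (tens_basis R u) nu.
Proof.
rewrite !ffunE mulr_sumr (reindex_inj (mulgI s)) /=; apply: eq_bigr => p _.
rewrite odd_permM signr_addb -mulrA !ffunE; congr (_ * (_ * (nat_of_bool _)%:R)).
apply/eqP/eqP => [/ffunP eq_u|<-]; last by apply/ffunP => l; rewrite !ffunE permM.
by apply/ffunP => l; have := eq_u ((s^-1)%g l); rewrite !ffunE permM !permKV.
Qed.

Lemma perm_homo_id (s : 'S_k) :
  (forall i j : 'I_k, (i < j)%N -> (s i < s j)%N) -> s = 1%g.
Proof.
have homo_ge (p : 'S_k) : (forall i j : 'I_k, (i < j)%N -> (p i < p j)%N) ->
    forall i : 'I_k, (i <= p i)%N.
  move=> p_homo [m]; elim: m => // m IHm ltmk.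
  have ltm : (m < k)%N by apply: ltnW.
  exact: leq_ltn_trans (IHm ltm) (p_homo (Ordinal ltm) (Ordinal ltmk) _).
move=> s_homo; apply/permP => i; rewrite perm1; apply/val_inj/eqP.
rewrite eqn_leq homo_ge // andbT -{2}[i](permK s).
apply: homo_ge => a b; apply: contraTT; rewrite -!leqNgt leq_eqVlt.
case/predU1P => [/val_inj/perm_inj->//|/s_homo].
by rewrite !permKV => /ltnW.
Qed.

(** A weakly increasing u is a permutation of the strictly increasing indices of
    nu only if it equals them: the permutation would have to be increasing. *)
Lemma wedge_sorted u nu :
  (forall i j : 'I_k, (i < j)%N -> (u i <= u j)%N) ->
  wedge (tens_basis R u) nu = (u == wedge_idx nu)%:R.
Proof.
move=> u_mono; rewrite ffunE (bigD1 1%g) //= odd_perm1 mul1r big1 ?addr0 => [|s /eqP ns1].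
  rewrite ffunE eq_sym; congr (nat_of_bool (_ == _))%:R.
  by apply/ffunP => j; rewrite ffunE perm1.
rewrite ffunE; case: eqP => [eq_u|_]; last by rewrite mulr0.
case: ns1; apply: perm_homo_id => i j ltij.
have eq_w l : u l = wedge_idx nu (s l) by rewrite -eq_u [LHS]ffunE.
have := u_mono i j ltij; rewrite !eq_w.
rewrite leqNgt => le_w; rewrite ltn_neqAle; apply/andP; split.
  by rewrite (inj_eq val_inj) (inj_eq perm_inj) -(inj_eq val_inj) ltn_eqF.
by rewrite leqNgt; apply: contra le_w => /wedge_idx_mono.
Qed.
End TensEval.

(** * The cone of nonnegative polynomials in the differences *)

Section Cone.
Variable n : nat.
Local Notation A := {mpoly int[n + n]}.
Implicit Types c : A.

Lemma nonneg_in_differences0 : nonneg_in_differences (0 : A).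
Proof. by exists 0; split=> [m|]; rewrite ?mcoeff0 ?raddf0. Qed.

Lemma nonneg_in_differences1 : nonneg_in_differences (1 : A).
Proof. by exists 1; split=> [m|]; rewrite ?mcoeff1 ?ler0n ?rmorph1. Qed.

Lemma nonneg_in_differencesD c1 c2 : nonneg_in_differences c1 ->
  nonneg_in_differences c2 -> nonneg_in_differences (c1 + c2).
Proof.
case=> p [p_ge0 ->] [q [q_ge0 ->]]; exists (p + q); rewrite raddfD.
by split=> // m; rewrite mcoeffD addr_ge0.
Qed.

Lemma nonneg_in_differencesM c1 c2 : nonneg_in_differences c1 ->
  nonneg_in_differences c2 -> nonneg_in_differences (c1 * c2).
Proof.
case=> p [p_ge0 ->] [q [q_ge0 ->]]; exists (p * q); rewrite rmorphM.
by split=> // m; rewrite mcoeffM sumr_ge0 // => l _; rewrite mulr_ge0.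
Qed.

Lemma nonneg_in_differences_sub (i j : 'I_n) :
  nonneg_in_differences (yvar i - zvar j).
Proof.
exists 'X_(enum_rank (i, j)); split=> [m|]; first by rewrite mcoeffX ler0n.
by rewrite comp_mpolyXU -tnth_nth tnth_mktuple enum_rankK.
Qed.
End Cone.

(** * Expansion into shifted tensors *)

(** The quantised Chern root enters only through its shape: it moves v_a to the
    cyclically next basis vector, with a coefficient wrap a, and scales it by
    y_a. *)
Section Action.
Variables n k : nat.
Local Notation A := {mpoly int[n + n]}.
Variables (R : comNzRingType) (phi : {rmorphism A -> R}).
Variables (X : 'M[R]_n) (wrap : 'I_n -> R).
Hypothesis XE : forall b a : 'I_n,
  X b a = wrap a *+ (b == ordS a) + phi (yvar a) *+ (b == a).
Variable w : {ffun 'I_k -> 'I_n}.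

Definition shift_idx (S : {set 'I_k}) : {ffun 'I_k -> 'I_n} :=
  [ffun i => if i \in S then ordS (w i) else w i].

(** The form preserved by the recursion of [felem]: f has acted on the factors
    before position j only, so that the factors from j on have not moved. *)
Definition shift_expansion j (f : {mpoly A[k]}) : Prop :=
  exists c : {set 'I_k} -> A,
  [/\ forall S, nonneg_in_differences (c S),
      forall (S : {set 'I_k}) (i : 'I_k), i \in S -> (j <= i)%N -> c S = 0
    & forall u, tens_eval X (map_mpoly phi f) (tens_basis R w) u
        = \sum_S (phi (c S) * \prod_(i in S) wrap (w i)) * (u == shift_idx S)%:R].

Lemma shift_expansion0 j : shift_expansion j 0.
Proof.
exists (fun _ => 0); split=> // [S|u]; first exact: nonneg_in_differences0.
rewrite raddf0 ffunE msupp0 big_nil big1 // => S _.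
by rewrite rmorph0 !mul0r.
Qed.

Lemma shift_expansion1 : shift_expansion 0 1.
Proof.
exists (fun S => (S == set0)%:R); split=> [S|S i iS _|u].
- by case: eqP => _; [apply: nonneg_in_differences1 | apply: nonneg_in_differences0].
- by case: eqP => // S0; rewrite S0 inE in iS.
rewrite rmorph1 tens_eval1 ffunE (bigD1 set0) //= big_set0 eqxx rmorph1 !mul1r.
rewrite big1 ?addr0 => [|S /negPf->]; last by rewrite rmorph0 !mul0r.
congr (nat_of_bool (_ == _))%:R.
by apply/ffunP => i; rewrite ffunE inE.
Qed.

Lemma shift_expansion_le j1 j2 f :
  (j1 <= j2)%N -> shift_expansion j1 f -> shift_expansion j2 f.
Proof.
move=> le_j [c [c_nonneg c_supp fE]]; exists c; split=> // S i iS lei.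
exact: c_supp iS (leq_trans le_j lei).
Qed.

Lemma shift_expansionD j f g :
  shift_expansion j f -> shift_expansion j g -> shift_expansion j (f + g).
Proof.
move=> [c [c_nonneg c_supp fE]] [d [d_nonneg d_supp gE]].
exists (fun S => c S + d S); split=> [S|S i iS lei|u].
- exact: nonneg_in_differencesD.
- by rewrite (c_supp S i) ?(d_supp S i) ?addr0.
have -> : map_mpoly phi (f + g) = map_mpoly phi f + map_mpoly phi g.
  exact: raddfD.
rewrite tens_evalD fE gE -big_split; apply: eq_bigr => S _.
by rewrite rmorphD !mulrDl.
Qed.

(** Factor j still carries v_(w j) in each term, so X_j - z_a either moves it or
    multiplies the term by y_(w j) - z_a. *)
Lemma shift_expansionX (j : 'I_k) (a : 'I_n) f :
  shift_expansion j f -> shift_expansion j.+1 (('X_j - (zvar a)%:MP) * f).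
Proof.
move=> [c [c_nonneg c_supp fE]].
exists (fun S : {set 'I_k} => if j \in S then c (S :\ j) else (yvar (w j) - zvar a) * c S).
split=> [S|S i iS ltji|u].
- case: ifP => _ //; apply: nonneg_in_differencesM => //.
  exact: nonneg_in_differences_sub.
- have neq_ij : i != j by rewrite -val_eqE gtn_eqF.
  case: ifP => _; last by rewrite (c_supp S i) ?mulr0 // ltnW.
  by apply: (c_supp _ i); [rewrite !inE neq_ij iS | exact: ltnW].
have -> : map_mpoly phi (('X_j - (zvar a)%:MP) * f)
          = 'X_j * map_mpoly phi f + (- phi (zvar a))%:MP * map_mpoly phi f.
  rewrite rmorphM rmorphB /= map_mpolyX map_mpolyC mulrBl.
  by rewrite mpolyCN mulNr.
rewrite tens_evalD tens_evalZ tens_evalX (tens_act_sum _ _ fE) fE.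
rewrite mulr_sumr -big_split /=.
rewrite (bigID (fun S : {set 'I_k} => j \in S)) /= [X in X + _]big1 ?add0r => [|S jS]; last first.
  by rewrite (c_supp S j) // rmorph0 !mul0r mulr0 addr0.
rewrite [RHS](bigID (fun S : {set 'I_k} => j \in S)) /=.
rewrite [X in _ = X + _](reindex_onto (fun S : {set 'I_k} => j |: S) (fun S => S :\ j)); last first.
  by move=> S jS; rewrite setD1K.
rewrite [X in _ = X + _](eq_bigl (fun S : {set 'I_k} => j \notin S)); last first.
  move=> S; rewrite setU11 /=; apply/eqP/idP => [<-|]; last exact: setU1K.
  by rewrite !inE eqxx.
rewrite -big_split; apply: eq_bigr => S jS /=.
rewrite setU11 (negPf jS) setU1K // big_setU1 //= XE.
have shift_j : shift_idx S j = w j by rewrite ffunE (negPf jS).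
have -> : shift_idx (j |: S) = set_idx (shift_idx S) j (ordS (w j)).
  by apply/ffunP => i; rewrite !ffunE !inE; case: eqVneq => [->|].
have -> : (u == shift_idx S) = (u == set_idx (shift_idx S) j (w j)).
  by congr (u == _); apply/ffunP => i; rewrite [RHS]ffunE; case: eqVneq => [->|].
have setE a' : (u == set_idx (shift_idx S) j a')
    = (u j == a') && (u == set_idx (shift_idx S) j (u j)).
  by case: (eqVneq (u j) a') => [<-//|neq_a]; apply/eqP => eq_u;
    rewrite eq_u ffunE !eqxx in neq_a.
rewrite shift_j !(setE (w j)) (setE (ordS (w j))) rmorphM rmorphB.
move: (phi (c S)) (\prod_(i in S) _) (wrap (w j)) (phi _) (phi _) => cS p e y z.
by case: (u == _); case: (u j == w j); case: (u j == _);
  rewrite /= ?mulr1n ?mulr0n; ring.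
Qed.
End Action.

Lemma shift_expansion_felem n k (R : comNzRingType)
    (phi : {rmorphism {mpoly int[n + n]} -> R}) (X : 'M[R]_n) (wrap : 'I_n -> R)
    (XE : forall b a : 'I_n,
      X b a = wrap a *+ (b == ordS a) + phi (yvar a) *+ (b == a))
    (w : {ffun 'I_k -> 'I_n}) (i0 : 'I_k) (a0 : 'I_n) j r :
  (j <= k)%N ->
  shift_expansion phi X wrap w j
    (felem (fun i => 'X_(insubd i0 i)) (fun a => (zvar (insubd a0 a))%:MP) j r).
Proof.
elim: j r => [|j IHj] [|r] ltjk /=.
- exact: shift_expansion1.
- exact: shift_expansion0.
- by apply: (shift_expansion_le (leqnSn j)); apply: IHj; apply: ltnW.
apply: shift_expansionD.
  by apply: (shift_expansion_le (leqnSn j)); apply: IHj; apply: ltnW.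
have jE : insubd i0 j = j :> nat by rewrite val_insubd ltjk.
by rewrite -{1}jE; apply: shift_expansionX => //; rewrite jE; apply/IHj/ltnW.
Qed.

(** * Signs under the wrap-around *)

Definition wrap_coef (R : comNzRingType) n k (q : R) (a : 'I_n) : R :=
  if a == n.-1 :> nat then (-1) ^+ k.-1 * q else 1.

Lemma chern_rootE n k (b a : 'I_n) :
  chern_root n k b a = wrap_coef k 'X a *+ (b == ordS a) + (yvar a)%:P *+ (b == a).
Proof.
rewrite /chern_root mxE.
have -> : (yvar b)%:P *+ (b == a) = (yvar a)%:P *+ (b == a)
    :> {poly {mpoly int[n + n]}}.
  by case: eqVneq => [->|].
congr +%R.
rewrite /wrap_coef -val_eqE /=; have := ltn_ord a; have := ltn_ord b.
case: (eqVneq (a : nat) n.-1) => [->|neq_a] ltb lta.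
  rewrite andbT prednK ?modnn; last exact: leq_ltn_trans ltb.
  by rewrite (ltn_eqF ltb) addr0.
by rewrite andbF add0r modn_small //; move: neq_a lta => /eqP; lia.
Qed.

(** Shifting the indices of mu at the positions in S keeps them weakly
    increasing, unless the last one wraps around from n - 1 to 0.  In that case
    they become weakly increasing after a rotation, whose sign is the one that
    accompanies q. *)
Lemma wedge_shift (R : comNzRingType) n k (q : R) (mu nu : boxpart n k.+1)
    (S : {set 'I_k.+1}) :
  exists e (b : bool),
    (\prod_(i in S) wrap_coef k.+1 q (wedge_idx mu i))
      * wedge (tens_basis R (shift_idx (wedge_idx mu) S)) nu = q ^+ e *+ b.
Proof.
set w := wedge_idx mu.
have w_mono (i j : 'I_k.+1) : (i < j)%N -> (w i < w j)%N := @wedge_idx_mono n k.+1 mu i j.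
have shiftE (i : 'I_k.+1) : w i != n.-1 :> nat -> shift_idx w S i = (w i + (i \in S))%N :> nat.
  move=> neq_wi; rewrite ffunE; case: (i \in S); rewrite ?addn0 ?addn1 //=.
  by rewrite modn_small //; have := ltn_ord (w i); move/eqP: neq_wi; lia.
have stayE (i : 'I_k.+1) : i \notin S -> shift_idx w S i = w i.
  by rewrite ffunE => /negPf->.
have not_last (i j : 'I_k.+1) : (i < j)%N -> w i != n.-1 :> nat.
  move=> /w_mono lt_w; have := ltn_ord (w j).
  by apply: contraTneq => eq_wi; move: lt_w; rewrite eq_wi -leqNgt; lia.
have shift_mono (i j : 'I_k.+1) : (i < j)%N -> ~~ ((j \in S) && (w j == n.-1 :> nat)) ->
    (shift_idx w S i <= shift_idx w S j)%N.
  move=> ltij; rewrite negb_and shiftE ?(not_last _ _ ltij) // => okj.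
  have le_w : (w i + (i \in S) <= w j)%N.
    apply: leq_trans (w_mono _ _ ltij).
    by rewrite -[X in (_ <= X)%N]addn1 leq_add2l leq_b1.
  case/orP: okj => [jS|neq_wj]; last by rewrite shiftE // (leq_trans le_w) ?leq_addr.
  by rewrite stayE.
have not_last_neq (i : 'I_k.+1) : i != ord_max -> w i != n.-1 :> nat.
  move=> neq_i; apply: (not_last i ord_max).
  by rewrite ltn_neqAle leq_ord andbT; exact: neq_i.
have [wrapS|no_wrap] := boolP ((ord_max \in S) && (w ord_max == n.-1 :> nat)).
  case/andP: wrapS => maxS w_max.
  (* The rotation that brings the last position to the front. *)
  pose s : 'S_k.+1 := lift_perm ord0 ord_max 1%g.
  exists 1%N, ([ffun l => shift_idx w S (s l)] == wedge_idx nu).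
  rewrite -mulr_natr expr1 -(wedge_sorted R) => [|i j ltij].
    rewrite wedge_perm (bigD1 ord_max) //= {1}/wrap_coef w_max big1 ?mulr1 => [|i].
      rewrite odd_lift_perm odd_perm1 addbF /= signr_odd mulrA.
      by rewrite [q * _]mulrC.
    by case/andP=> _ /not_last_neq/negPf neq_wi; rewrite /wrap_coef neq_wi.
  have sE l : [ffun l => shift_idx w S (s l)] l = shift_idx w S (s l) by rewrite ffunE.
  rewrite !sE; case: (unliftP ord0 j) ltij => [j'|] -> //.
  case: (unliftP ord0 i) => [i'|] -> ltij; rewrite /s ?lift_perm_id ?lift_perm_lift ?perm1.
    apply: shift_mono; first by rewrite !lift_max.
    by rewrite negb_and not_last_neq ?orbT // eq_sym neq_lift.
  rewrite [X in (X <= _)%N](_ : _ = 0%N) // ffunE maxS /= (eqP w_max).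
  by rewrite prednK ?modnn // (leq_ltn_trans _ (ltn_ord (w ord0))).
exists 0%N, (shift_idx w S == wedge_idx nu).
rewrite big1 => [|i iS].
  rewrite mul1r wedge_sorted // => i j ltij; apply: shift_mono => //.
  have [->//|/not_last_neq/negPf->] := eqVneq j ord_max; by rewrite andbF.
have [eq_i|/not_last_neq/negPf neq_wi] := eqVneq i ord_max; last first.
  by rewrite /wrap_coef neq_wi.
by move: no_wrap; rewrite -eq_i iS /wrap_coef /= => /negPf->.
Qed.

Theorem corollary4p14 (n k r d : nat) (le2n : (2 <= n)%N) (le1k : (1 <= k)%N)
    (ltkn : (k < n)%N) (le1r : (1 <= r)%N) (lerk : (r <= k)%N)
    (mu nu : boxpart n k) :
  nonneg_in_differences (tqcoef (colpart ltkn r) mu nu d).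
Proof.
case: k le1k ltkn lerk mu nu => // k _ ltkn lerk mu nu.
have a0 : 'I_n := Ordinal (ltn_trans (ltn0Sn k) ltkn).
rewrite /tqcoef /tqprod (fschur_colpart ltkn ord0 a0) ?le1r //.
have [c [c_nonneg _ cE]] := shift_expansion_felem (@chern_rootE n k.+1) (wedge_idx mu)
  ord0 a0 r (leqnn k.+1).
rewrite (wedge_sum cE) coef_sum.
elim/big_ind: _ => [||S _].
- exact: nonneg_in_differences0.
- exact: nonneg_in_differencesD.
have [e [b eE]] := @wedge_shift {poly {mpoly int[n + n]}} n k 'X mu nu S.
rewrite -mulrA eE coefCM coefMn coefXn.
case: (d == e); case: b {eE}; rewrite ?mulr1 ?mulr0 //.
all: exact: nonneg_in_differences0.
Qed.
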